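(* Let $\mathcal{E}\subsetneq E$ be a non-cut set outage for the connected power network $G=(V,E,\bm{b})$. Let $E=E_1\cup\dots\cup E_k$ be the block decomposition of the edge set, and put $\mathcal{E}_j=\mathcal{E}\cap E_j$ and $\mathcal{E}_{-j}=E_j\setminus\mathcal{E}_j$ for $j=1,\dots,k$, with the lines of $\mathcal{E}$ and of $-\mathcal{E}=E\setminus\mathcal{E}$ ordered by blocks. Then the PTDF submatrices $D_{-\mathcal{E}\mathcal{E}}$ and $D_{\mathcal{E}\mathcal{E}}$ decompose as $$D_{-\mathcal{E}\mathcal{E}}=\begin{bmatrix}D_{-1}&0&\dots&0\\0&D_{-2}&\dots&0\\\vdots&\vdots&\ddots&\vdots\\0&0&\dots&D_{-k}\end{bmatrix},\qquad D_{\mathcal{E}\mathcal{E}}=\begin{bmatrix}D_1&0&\dots&0\\0&D_2&\dots&0\\\vdots&\vdots&\ddots&\vdots\\0&0&\dots&D_k\end{bmatrix},$$ where, for each $j=1,\dots,k$, $D_{-j}$ is the $|\mathcal{E}_{-j}|\times|\mathcal{E}_j|$ matrix $D_{-j}=B_{-j}C_{-j}^TL^\dag C_j$ and $D_j$ is the $|\mathcal{E}_j|\times|\mathcal{E}_j|$ matrix $D_j=B_jC_j^TL^\dag C_j$. Furthermore, the LODF matrix $K_{-\mathcal{E}\mathcal{E}}=D_{-\mathcal{E}\mathcal{E}}\,(I-\mathrm{diag}(D_{\mathcal{E}\mathcal{E}}))^{-1}$ also has a block-diagonal structure, namely $$K_{-\mathcal{E}\mathcal{E}}=\begin{bmatrix}K_1&0&\dots&0\\0&K_2&\dots&0\\\vdots&\vdots&\ddots&\vdots\\0&0&\dots&K_k\end{bmatrix},$$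 where $K_j$ is the $|\mathcal{E}_{-j}|\times|\mathcal{E}_j|$ matrix $K_j=D_{-j}\,(I-\mathrm{diag}(D_j))^{-1}$ for $j=1,\dots,k$.
   Context: A power network $G=(V,E,\bm{b})$ is a finite simple undirected graph with $n=|V|$ vertices and $m=|E|$ edges (called lines), where each line $\ell=(i,j)$ has a susceptance $b_\ell>0$ and an arbitrary fixed orientation. $B=\mathrm{diag}(b_1,\dots,b_m)$; $C\in\{-1,0,1\}^{n\times m}$ is the vertex-edge incidence matrix ($C_{i\ell}=1$ if $i$ is the source of $\ell$, $-1$ if $i$ is the target of $\ell$, $0$ otherwise); $L=CBC^T$ is the weighted Laplacian and $L^\dag$ its Moore-Penrose pseudo-inverse. The PTDF matrix is the $m\times m$ matrix $D=BC^TL^\dag C$, whose entry for lines $\ell=(i,j)$, $\hat\ell=(s,t)$ is $D_{\ell\hat\ell}=b_\ell(L^\dag_{is}+L^\dag_{jt}-L^\dag_{it}-L^\dag_{js})$. A set $\mathcal{E}\subsetneq E$ is a non-cut set if $(V,E\setminus\mathcal{E})$ is still connected. Put $-\mathcal{E}=E\setminus\mathcal{E}$. For such $\mathcal{E}$, $D_{-\mathcal{E}\mathcal{E}}$ and $D_{\mathcal{E}\mathcal{E}}$ are the submatrices of $D$ with columns indexed by $\mathcal{E}$ and rows indexed by $-\mathcal{E}$ and $\mathcal{E}$, respectively. For a square matrix $M$, $\mathrm{diag}(M)$ is the diagonal matrix with the same diagonal entries as $M$. The entries of the LODF matrix $K_{-\mathcal{E}\mathcal{E}}$ are the single-line outage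 factors $K_{\ell\hat\ell}=D_{\ell\hat\ell}/(1-D_{\hat\ell\hat\ell})$, $\ell\in-\mathcal{E}$, $\hat\ell\in\mathcal{E}$. Blocks: two edges are equivalent if they are equal or there is a simple cycle containing both; the equivalence classes $E_1,\dots,E_k$ form the block decomposition of the edge set $E$. $B_j$, $B_{-j}$ denote the diagonal submatrices of $B$ for the lines in $\mathcal{E}_j$, $\mathcal{E}_{-j}$, and $C_j$, $C_{-j}$ the submatrices of $C$ consisting of the columns for the lines in $\mathcal{E}_j$, $\mathcal{E}_{-j}$. Some of the sets $\mathcal{E}_j$, $\mathcal{E}_{-j}$ may be empty, in which case the corresponding blocks have zero columns or rows. *)

(* Defs.v *)
From mathcomp Require Import all_boot all_order all_algebra.
Set Implicit Arguments.
Unset Strict Implicit.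
Unset Printing Implicit Defensive.
Import Order.TTheory GRing.Theory Num.Theory.
Local Open Scope ring_scope.

(* MathComp's pinvmx is only a one-sided inverse on the row space and in      *)
(* general not the Moore-Penrose pseudo-inverse, hence this section.          *)
Section MoorePenrose.
Variable R : realFieldType.

Definition moore_penrose m n (A : 'M[R]_(m, n)) (X : 'M[R]_(n, m)) : bool :=
  [&& A *m X *m A == A, X *m A *m X == X,
      (A *m X)^T == A *m X & (X *m A)^T == X *m A].

Lemma gram_unitmx m n (X : 'M[R]_(m, n)) :
  row_free X -> X *m X^T \in unitmx.
Proof.
move=> Xfree; rewrite -row_free_unit -kermx_eq0; apply/rowV0P => v.
move/sub_kermxP=> vXX0; apply/eqP; rewrite -(mulmx_free_eq0 v Xfree).
have : (v *m X) *m (v *m X)^T = 0.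
  by rewrite trmx_mul mulmxA -(mulmxA v) vXX0 mul0mx.
move/matrixP/(_ 0 0); rewrite !mxE => /eqP; rewrite psumr_eq0; last first.
  by move=> i _; rewrite [X in _ * X]mxE -expr2 sqr_ge0.
move/allP=> v0; apply/eqP/rowP=> j; rewrite [RHS]mxE; apply/eqP.
by have := v0 j (mem_index_enum j); rewrite [X in _ * X]mxE mulf_eq0 orbb.
Qed.

Lemma moore_penrose_factor m n r (F : 'M[R]_(m, r)) (G : 'M[R]_(r, n)) :
  row_free F^T -> row_free G ->
  moore_penrose (F *m G)
    (G^T *m invmx (G *m G^T) *m invmx (F^T *m F) *m F^T).
Proof.
move=> /gram_unitmx; rewrite trmxK => FF /gram_unitmx GG.
set H := invmx (G *m G^T); set K := invmx (F^T *m F).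
have HT : H^T = H by rewrite trmx_inv trmx_mul trmxK.
have KT : K^T = K by rewrite trmx_inv trmx_mul trmxK.
set A := F *m G; set X := _ *m F^T.
have AX : A *m X = F *m K *m F^T.
  by rewrite /A /X !mulmxA -2!(mulmxA F) mulmxV // mulmx1.
have XA : X *m A = G^T *m H *m G.
  by rewrite /A /X -!mulmxA (mulmxA F^T) (mulmxA K) mulVmx // mul1mx.
apply/and4P; split; apply/eqP.
- by rewrite AX /A -!mulmxA (mulmxA F^T) (mulmxA K) mulVmx // mul1mx.
- by rewrite XA /X -!mulmxA (mulmxA G) (mulmxA H (G *m G^T)) mulVmx // mul1mx.
- by rewrite AX !trmx_mul trmxK KT mulmxA.
- by rewrite XA !trmx_mul trmxK HT mulmxA.
Qed.

Lemma moore_penrose_exists m n (A : 'M[R]_(m, n)) :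
  exists X, moore_penrose A X.
Proof.
rewrite -(mulmx_base A); eexists; apply: moore_penrose_factor.
  by rewrite /row_free mxrank_tr; apply: col_base_full.
exact: row_base_free.
Qed.

Lemma moore_penrose_unique m n (A : 'M[R]_(m, n)) X Y :
  moore_penrose A X -> moore_penrose A Y -> X = Y.
Proof.
move=> /and4P[/eqP AXA /eqP XAX /eqP AXt /eqP XAt].
move=> /and4P[/eqP AYA /eqP YAY /eqP AYt /eqP YAt].
have AXY : A *m X = A *m Y.
  by rewrite -AXt -{1}AYA -mulmxA trmx_mul AXt AYt mulmxA AXA.
have XAY : X *m A = Y *m A.
  by rewrite -XAt -{1}AYA -mulmxA mulmxA trmx_mul YAt XAt -mulmxA (mulmxA A) AXA.
by rewrite -XAX -mulmxA AXY mulmxA XAY YAY.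
Qed.

Definition mpinv m n (A : 'M[R]_(m, n)) : 'M[R]_(n, m) :=
  xchoose (moore_penrose_exists A).

Lemma mpinvP m n (A : 'M[R]_(m, n)) : moore_penrose A (mpinv A).
Proof. exact: xchooseP. Qed.

End MoorePenrose.

(* Vertices are 'I_n and lines are 'I_m; line l is oriented from src l to     *)
(* tgt l. Injectivity of l |-> {src l, tgt l} excludes parallel lines, also   *)
(* with opposite orientations.                                                *)
Record power_network (R : realFieldType) (n m : nat) := PowerNetwork {
  src : 'I_m -> 'I_n;
  tgt : 'I_m -> 'I_n;
  susc : 'I_m -> R;
  src_neq_tgt : forall l, src l != tgt l;
  ends_inj : injective (fun l => [set src l; tgt l]);
  susc_gt0 : forall l, 0 < susc l }.

Section Graph.
Variables (R : realFieldType) (n m : nat) (G : power_network R n m).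

Definition ends (l : 'I_m) : {set 'I_n} := [set src G l; tgt G l].

Definition adjacent (A : {set 'I_m}) : rel 'I_n :=
  fun x y => [exists l in A, ends l == [set x; y]].

Definition connected_by (A : {set 'I_m}) : Prop :=
  forall x y, connect (adjacent A) x y.

Definition non_cut (A : {set 'I_m}) : Prop :=
  A \proper [set: 'I_m] /\ connected_by (~: A).

(* ucycle also accepts the sequence [:: x; y] for adjacent x and y, which     *)
(* traverses one line twice; hence the bound on the size.                     *)
Definition simple_cycle (p : seq 'I_n) : Prop :=
  (2 < size p)%N /\ ucycle (adjacent [set: 'I_m]) p.

Definition on_cycle (p : seq 'I_n) (l : 'I_m) : Prop :=
  exists2 x, x \in p & ends l = [set x; next p x].

Definition same_block (l l' : 'I_m) : Prop :=
  l = l' \/ exists p, [/\ simple_cycle p, on_cycle p l & on_cycle p l'].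

(* Eb lists, without repetition, the equivalence classes of same_block.       *)
Definition block_decomposition k (Eb : 'I_k -> {set 'I_m}) : Prop :=
  injective Eb /\
  forall A : {set 'I_m},
    (exists j, Eb j = A) <->
    (exists l, forall l', l' \in A <-> same_block l l').

Definition incidence : 'M[R]_(n, m) :=
  \matrix_(i, l) if i == src G l then 1 else if i == tgt G l then -1 else 0.

Definition susceptance : 'M[R]_m := diag_mx (\row_l susc G l).

Definition laplacian : 'M[R]_n := incidence *m susceptance *m incidence^T.

Definition ptdf : 'M[R]_m :=
  susceptance *m incidence^T *m mpinv laplacian *m incidence.

Definition lodf : 'M[R]_m :=
  \matrix_(l, l') (ptdf l l' / (1 - ptdf l' l')).

(* The matrix B_e C_e^T L^+ C_f for lists of lines e and f.                   *)
Definition ptdf_block p q (e : 'I_p -> 'I_m) (f : 'I_q -> 'I_m) :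
    'M[R]_(p, q) :=
  mxsub e e susceptance *m (colsub e incidence)^T *m mpinv laplacian
    *m colsub f incidence.

End Graph.

Section Blocks.
Variables (m k : nat).

(* e lists the lines of A, each once, first those in F 0, then those in F 1,  *)
(* and so on; tagnat.Rank j r is the position of the r-th index of group j.   *)
Definition block_ordering (F : 'I_k -> {set 'I_m}) (A : {set 'I_m})
    (e : 'I_(\sum_j #|F j|) -> 'I_m) : Prop :=
  [/\ injective e,
      forall l, l \in A <-> exists s, e s = l
    & forall j (r : 'I_#|F j|), e (tagnat.Rank j r) \in F j].

Definition group_of (d : 'I_k -> nat) (e : 'I_(\sum_j d j) -> 'I_m) (j : 'I_k) :
    'I_(d j) -> 'I_m :=
  fun r => e (tagnat.Rank j r).

End Blocks.

(* Version of mxdiag for rectangular blocks.                                  *)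
Definition rect_mxdiag (R : nmodType) k (p q : 'I_k -> nat)
    (M : forall j, 'M[R]_(p j, q j)) : 'M[R]_(\sum_j p j, \sum_j q j) :=
  \mxblock_(i, j) if i == j then conform_mx 0 (M j) else 0.

Definition diag_part (R : nmodType) p (M : 'M[R]_p) : 'M[R]_p :=
  diag_mx (\row_i M i i).

(* Main.v *)
Require Import Defs.
From mathcomp Require Import all_boot all_order all_algebra.
From mathcomp Require Import boolp.
Import Order.TTheory GRing.Theory Num.Theory.
Local Open Scope ring_scope.
Set Implicit Arguments.
Unset Strict Implicit.
Unset Printing Implicit Defensive.

(** Column [l'] of the PTDF matrix is the current that flows when one unit is
    injected at the source of line [l'] and withdrawn at its target: its entries
    are [b_l] times the drops of a potential that satisfies Kirchhoff's current
    law ([ptdfE], [divergence_potential]).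

    If line [l] carries current, start at its end of higher potential.  By
    Kirchhoff's law a vertex that sends current to a lower neighbour receives it
    from a higher one, unless it is the source of the transfer; so one can climb
    from [l] to the source of [l'] and, dually, descend from [l] to the target
    of [l'].  The potential is strictly monotone along the resulting path,
    hence the path is simple, and [l'] closes it to a simple cycle through [l]
    and [l'] ([flow_same_block]).  Thus [ptdf G l l'] vanishes unless [l] and
    [l'] lie on a common cycle or are equal.

    That distinct blocks are disjoint need not be derived from transitivity of
    the block relation: a list of lines without repetition, grouped by blocks,
    can only exist when the groups are disjoint ([block_ordering_disjoint]).

    Finally the diagonal entry at a line [l] whose removal leaves the network
    connected differs from 1 ([ptdf_neq1]): otherwise all the energy of the
    transfer would be dissipated in [l], and the ends of [l], being connected
    through lines without current, would have the same potential.  So the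
    diagonal matrices to be inverted are invertible, and the structure of the
    LODF matrix follows from that of the PTDF matrices. *)

(** * Potentials and Kirchhoff's laws *)

Section Electrical.
Variables (R : realFieldType) (n m : nat) (G : power_network R n m).
Implicit Types (f : 'I_n -> R) (l : 'I_m) (v : 'I_n).

(** The current on line [l] under the potential [f], counted from source to
    target. *)
Definition flow f l : R := susc G l * (f (src G l) - f (tgt G l)).

(** The net current leaving vertex [v] under the potential [f]. *)
Definition divergence f v : R := \sum_l incidence G v l * flow f l.

(** The potential induced by one unit injected at the source of [l] and
    withdrawn at its target. *)
Definition potential l v : R := (mpinv (laplacian G) *m incidence G) v l.

Lemma incidence_sum f l :
  \sum_v incidence G v l * f v = f (src G l) - f (tgt G l).
Proof.
rewrite (bigD1 (src G l)) //= (bigD1 (tgt G l)) /=; last first.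
  by rewrite eq_sym src_neq_tgt.
rewrite big1 => [|v /andP[vs vt]]; last first.
  by rewrite mxE (negPf vs) (negPf vt) mul0r.
rewrite !mxE !eqxx eq_sym (negPf (src_neq_tgt G l)).
by rewrite addr0 mul1r mulN1r.
Qed.

(** The flow on a line, counted outwards from either of its ends. *)
Lemma incidence_flow f l v w : ends G l = [set v; w] ->
  incidence G v l * flow f l = susc G l * (f v - f w).
Proof.
move/setP=> eq_ends; have nst := src_neq_tgt G l.
have := eq_ends v; rewrite !inE eqxx mxE => /orP[]/eqP v_end; subst v.
  have := eq_ends (tgt G l); rewrite !inE eqxx orbT eq_sym (negPf nst) /=.
  by move/esym/eqP => <-; rewrite eqxx mul1r.
have := eq_ends (src G l); rewrite !inE eqxx (negPf nst) /= => /esym/eqP <-.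
by rewrite eq_sym (negPf nst) eqxx mulN1r -mulrN opprB.
Qed.

(** Gram matrices lose no range: with [Q] the defect of [L *m mpinv L] from
    the identity, [Q *m L = 0] makes the diagonal of [(Q C) B (Q C)^T], a
    weighted sum of squares with positive weights, vanish. *)
Lemma laplacian_mpinv_incidence :
  laplacian G *m mpinv (laplacian G) *m incidence G = incidence G.
Proof.
set L := laplacian G; set C := incidence G.
have /and4P[/eqP LXL _ _ _] := mpinvP L.
pose Q := 1%:M - L *m mpinv L.
suff QC : Q *m C = 0.
  by apply/eqP; rewrite eq_sym -subr_eq0 -{1}[C]mul1mx -mulmxBl -/Q QC.
have QCB : (Q *m C) *m susceptance G *m (Q *m C)^T = 0.
  rewrite trmx_mul !mulmxA -(mulmxA Q C) -(mulmxA Q) -/(laplacian G) -/L.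
  by rewrite mulmxBl mul1mx LXL subrr mul0mx.
move: (Q *m C) QCB => N NBN; apply/matrixP=> i l; rewrite [RHS]mxE.
have /matrixP/(_ i i) := NBN.
rewrite /susceptance mul_mx_diag !mxE => /eqP.
rewrite psumr_eq0 => [|j _]; last first.
  by rewrite !mxE mulrAC -expr2 mulr_ge0 ?sqr_ge0 // ltW ?susc_gt0.
move/allP/(_ l (mem_index_enum l)).
rewrite !mxE mulrAC -expr2 mulf_eq0 sqrf_eq0.
by rewrite [susc G l == 0]gt_eqF ?susc_gt0 //= orbF => /eqP.
Qed.

Lemma ptdfE l l' : ptdf G l l' = flow (potential l') l.
Proof.
rewrite /ptdf -mulmxA -mulmxA /susceptance mul_diag_mx !mxE /flow.
congr (_ * _); rewrite -incidence_sum; apply: eq_bigr => v _.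
by rewrite [X in X * _]mxE.
Qed.

(** Kirchhoff's current law for a unit transfer between the ends of [l]. *)
Lemma divergence_potential l v : divergence (potential l) v = incidence G v l.
Proof.
rewrite -[in RHS]laplacian_mpinv_incidence -!mulmxA mxE.
apply: eq_bigr => l' _; congr (_ * _).
by rewrite -ptdfE /ptdf !mulmxA.
Qed.

Lemma divergenceN f v : divergence (fun w => - f w) v = - divergence f v.
Proof.
rewrite -sumrN; apply: eq_bigr => l _.
by rewrite /flow -mulrN -mulrN opprB addrC opprK.
Qed.

(** * Cycles through a line that carries current *)

(** The relation of stepping along a line to a vertex of higher potential. *)

Definition climbs f : rel 'I_n :=
  fun v w => adjacent G [set: 'I_m] v w && (f v < f w).

(** A vertex that is not a source and that feeds a lower neighbour is fed by a
    higher neighbour. *)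
Lemma climbs_step f v w :
  divergence f v <= 0 -> climbs f w v -> exists u, climbs f v u.
Proof.
move=> div_le0 /andP[/existsP[l /andP[_ /eqP endl]] fwv].
apply/existsP; apply: contraLR div_le0; rewrite negb_exists => /forallP nup.
have le_nbr l' u : ends G l' = [set v; u] -> f u <= f v.
  move=> endl'; have := nup u; rewrite /climbs.
  suff -> : adjacent G [set: 'I_m] v u by rewrite /= -leNgt.
  by apply/existsP; exists l'; rewrite inE endl' eqxx.
have out_ge0 l' : 0 <= incidence G v l' * flow f l'.
  have [/set2P vl'|vl'] := boolP (v \in ends G l'); last first.
    move: vl'; rewrite !inE negb_or mxE => /andP[/negPf-> /negPf->].
    by rewrite mul0r.
  have [u endu] : exists u, ends G l' = [set v; u].
    by case: vl' => ->; [exists (tgt G l')|exists (src G l'); rewrite setUC].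
  rewrite (incidence_flow f endu) mulr_ge0 ?(ltW (susc_gt0 _ _)) // subr_ge0.
  exact: (le_nbr l').
rewrite -ltNge lt_neqAle eq_sym sumr_ge0 // andbT.
rewrite psumr_eq0 //; apply/allP => /(_ l (mem_index_enum l)) /=.
rewrite (@incidence_flow f l v w); last by rewrite endl setUC.
by rewrite mulf_eq0 !gt_eqF ?subr_gt0 ?susc_gt0.
Qed.

(** Hence a climb can only end at the source; it ends because fewer and fewer
    vertices lie higher. *)
Lemma climbs_to_source f s v w :
    (forall u, u != s -> divergence f u <= 0) -> climbs f w v ->
  exists2 p, path (climbs f) v p & last v p = s.
Proof.
move=> kcl; have [k] := ubnP #|[set u | f v < f u]|.
elim: k v w => // k IHk v w ltk wv.
have [->|nvs] := eqVneq v s; first by exists [::].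
have [u vu] := climbs_step (kcl v nvs) wv.
have /(_ u v)[||p up lastp] := IHk; last by exists (u :: p); rewrite //= vu.
  have /andP[_ fvu] := vu.
  rewrite -ltnS (leq_trans _ ltk) // ltnS proper_card //.
  apply/properP; split; last by exists u; rewrite !inE ?fvu ?ltxx.
  by apply/subsetP => x; rewrite !inE; apply: lt_trans.
exact: vu.
Qed.

Lemma adjacentC A : symmetric (adjacent G A).
Proof. by move=> v w; apply: eq_existsb => l; rewrite setUC. Qed.

(** Negating the potential turns statements on climbs into statements on
    descents. *)
Lemma climbsN f v w : climbs (fun u => - f u) v w = climbs f w v.
Proof. by rewrite /climbs ltrN2 adjacentC. Qed.

(** The cycle through [l] and [l'] made of the descent from the source of [l'],
    through [l], to the target of [l']; strict monotony of the potential makes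
    it simple. *)
Lemma flow_same_block l l' : ptdf G l l' != 0 -> same_block G l' l.
Proof.
have [->|nll'] := eqVneq l l'; first by left.
rewrite ptdfE => flow_neq0; right.
set f := potential l'; set s := src G l'; set t := tgt G l'.
have [x [y [endl fyx]]] : exists x y, ends G l = [set x; y] /\ f y < f x.
  have : f (src G l) != f (tgt G l).
    by apply: contraNneq flow_neq0; rewrite /flow /f => ->; rewrite subrr mulr0.
  case: ltgtP => // flt _; first by exists (tgt G l), (src G l); rewrite /ends setUC.
  by exists (src G l), (tgt G l).
have adjxy : adjacent G [set: 'I_m] x y.
  by apply/existsP; exists l; rewrite inE endl eqxx.
have yx : climbs f y x by rewrite /climbs adjacentC adjxy.
have [u us|p upp lastp] := climbs_to_source (s := s) _ yx.
  by rewrite divergence_potential mxE (negPf us); case: ifP; rewrite ?lerN10.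
have [u ut||q dnq lastq] := @climbs_to_source (fun u => - f u) t y x.
- rewrite divergenceN divergence_potential mxE (negPf ut).
  by case: ifP; rewrite ?lerN10 ?oppr_le0.
- by rewrite climbsN.
have {}dnq : path (fun v w => climbs f w v) y q.
  by rewrite -(eq_path (climbsN f)).
(* The cycle is listed from [x], so that [next] can be computed: first [l] to
   [y], then the descent to [t], then [l'] to [s], then the descent to [x].  If
   [p] is empty then [s] is [x] and the step along [l'] closes the cycle. *)
pose c := x :: (y :: q) ++ rev p.
have revE : rev (x :: p) = s :: rev (belast x p).
  by rewrite lastI rev_rcons lastp.
have rev_dn : path (fun v w => climbs f w v) s (rev (belast x p)).
  by rewrite -lastp rev_path.
have down_adj a r : path (fun v w => climbs f w v) a r ->
    path (adjacent G [set: 'I_m]) a r.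
  by apply: sub_path => v w /andP[]; rewrite adjacentC.
have cycc : cycle (adjacent G [set: 'I_m]) c.
  rewrite /c /cycle rcons_cat -rev_cons revE /= cat_path /= adjxy lastq.
  rewrite !down_adj //= andbT; apply/existsP; exists l'.
  by rewrite inE /ends setUC eqxx.
have uniqc : uniq c.
  rewrite /c -cat_cons uniq_catC -cat_rcons -rev_cons revE.
  apply: (@sorted_uniq _ (fun v w => f w < f v)).
  - by move=> a b d ba db; apply: lt_trans ba.
  - by move=> a; rewrite ltxx.
  have lastx : last s (rev (belast x p)) = x.
    by rewrite -[LHS]/(last s (s :: rev (belast x p))) -revE rev_cons last_rcons.
  apply: (@sub_path _ (fun v w => climbs f w v)) => [v w /andP[]//|].
  by rewrite cat_path rev_dn lastx /= yx.
exists c; split; first split.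
- (* A cycle of two vertices would make [l] and [l'] parallel lines. *)
  rewrite /c /= size_cat size_rev !ltnS addn_gt0.
  apply: contraNT nll'; rewrite negb_or -!eqn0Ngt !size_eq0 => /andP[q0 p0].
  apply/eqP/(@ends_inj _ _ _ G); rewrite -/(ends G l) endl.
  rewrite -[x]/(last x [::]) -(eqP p0) lastp.
  by rewrite -[y]/(last y [::]) -(eqP q0) lastq.
- by rewrite /ucycle cycc uniqc.
- have tc : t \in y :: q by rewrite -lastq mem_last.
  exists t; first by rewrite inE mem_cat tc orbT.
  rewrite /ends setUC; congr [set _; _].
  rewrite next_nth {1}/c inE mem_cat tc orbT.
  have -> : index t c = (size q).+1.
    have := uniqc; rewrite /c -cat_cons cat_uniq => /andP[uq _].
    rewrite index_cat inE tc orbT -lastq.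
    by rewrite -[last y q]/(last x (y :: q)) index_last.
  rewrite -[RHS]/(nth x ((y :: q) ++ rev p) (size (y :: q))).
  rewrite nth_cat ltnn subnn nth0.
  (* For empty [p] the default value [x] of [head] is [s]. *)
  case/lastP: p lastp {upp c revE rev_dn cycc uniqc} => [|p a] //=.
  by rewrite last_rcons rev_rcons.
- exists x; first exact: mem_head.
  by rewrite /c /= eqxx.
Qed.

(** * The self-factor of a line that is not a bridge *)

(** A unit transfer between the ends of [l] has energy equal to the potential
    drop over [l].  If [l] carried the whole unit, then no other line would
    dissipate, so that a path avoiding [l] would equalise the potentials of the
    ends of [l]. *)
Lemma ptdf_neq1 (A : {set 'I_m}) l :
  l \notin A -> connected_by G A -> ptdf G l l != 1.
Proof.
move=> lA conA; rewrite ptdfE; set f := potential l.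
apply/eqP => flow1.
have energy : \sum_l' flow f l' * (f (src G l') - f (tgt G l')) =
    f (src G l) - f (tgt G l).
  rewrite -[RHS]incidence_sum.
  under [RHS]eq_bigr do rewrite -divergence_potential mulr_suml.
  rewrite exchange_big /=; apply: eq_bigr => l' _.
  rewrite -incidence_sum mulr_sumr; apply: eq_bigr => v _.
  by rewrite mulrCA mulrA.
have : \sum_(l' | l' != l) flow f l' * (f (src G l') - f (tgt G l')) = 0.
  move: energy; rewrite (bigD1 l) //= flow1 mul1r => /(canRL (addKr _)).
  by rewrite addNr.
move/eqP; rewrite psumr_eq0 => [/allP zero|l' _]; last first.
  by rewrite /flow -mulrA -expr2 mulr_ge0 ?sqr_ge0 // ltW ?susc_gt0.
have step v w : adjacent G A v w -> f v = f w.
  case/existsP => l' /andP[l'A /eqP endl'].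
  have nl : l' != l by apply: contraNneq lA => <-.
  have := zero l' (mem_index_enum _); rewrite nl /= /flow -mulrA -expr2.
  rewrite mulf_eq0 sqrf_eq0 [susc G l' == 0]gt_eqF ?susc_gt0 //= subr_eq0 => /eqP feq.
  have cst u : u \in ends G l' -> f u = f (src G l').
    by rewrite !inE => /orP[]/eqP->.
  by rewrite !cst // endl' !inE eqxx ?orbT.
have : f (src G l) = f (tgt G l).
  have /connectP[p] := conA (src G l) (tgt G l).
  elim: p (src G l) => [|w p IHp] v /=; first by move=> _ ->.
  by case/andP=> /step -> pw; apply: IHp.
move=> feq; move: flow1; rewrite /flow feq subrr mulr0 => /eqP.
by rewrite eq_sym oner_eq0.
Qed.

(** Injectivity of [e] is needed: otherwise [mxsub e e] of a diagonal matrix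
    has nonzero entries off the diagonal. *)
Lemma ptdf_blockE p q (e : 'I_p -> 'I_m) (g : 'I_q -> 'I_m) :
  injective e -> ptdf_block G e g = mxsub e g (ptdf G).
Proof.
move=> inj_e; rewrite /ptdf_block /ptdf /susceptance.
have -> : mxsub e e (diag_mx (\row_l susc G l)) = diag_mx (\row_i susc G (e i)).
  by apply/matrixP => i j; rewrite !mxE (inj_eq inj_e).
rewrite -!mulmxA !mul_diag_mx; apply/matrixP => i j; rewrite !mxE.
congr (_ * _); apply: eq_bigr => v _.
by rewrite !mxE; congr (_ * _); apply: eq_bigr => w _; rewrite !mxE.
Qed.

End Electrical.

(** * Orderings of lines by blocks *)

(** Group [j] of the list has [#|F j|] distinct entries, all in [F j], so that
    it exhausts [F j]. *)
Lemma block_ordering_mem m k (F : 'I_k -> {set 'I_m}) A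
    (e : 'I_(\sum_j #|F j|) -> 'I_m) j l :
  block_ordering A e -> l \in F j -> exists r, e (tagnat.Rank j r) = l.
Proof.
case=> inj_e _ eF lFj; pose h r := e (tagnat.Rank j r).
have inj_h : injective h.
  move=> r r' /inj_e/eqP; rewrite -val_eqE /= tagnat.eq_Rank eqxx /= => /eqP.
  exact: val_inj.
have : h @: [set: _] = F j.
  apply/eqP; rewrite eqEcard card_imset // cardsT card_ord leqnn andbT.
  by apply/subsetP => _ /imsetP[r _ ->]; apply: eF.
by move/setP/(_ l); rewrite lFj => /imsetP[r _ ->]; exists r.
Qed.

(** A list without repetition can have each line in one group only. *)
Lemma block_ordering_disjoint m k (F : 'I_k -> {set 'I_m}) A
    (e : 'I_(\sum_j #|F j|) -> 'I_m) i j l :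
  block_ordering A e -> l \in F i -> l \in F j -> i = j.
Proof.
move=> ordA /(block_ordering_mem ordA)[r <-].
case/(block_ordering_mem ordA) => r'; case: ordA => inj_e _ _ /inj_e/eqP.
by rewrite -val_eqE /= tagnat.eq_Rank => /andP[/eqP].
Qed.

Lemma group_of_inj m k (d : 'I_k -> nat) (e : 'I_(\sum_j d j) -> 'I_m) j :
  injective e -> injective (group_of e (j := j)).
Proof.
move=> inj_e r r' /inj_e/eqP.
by rewrite -val_eqE /= tagnat.eq_Rank eqxx => /eqP/val_inj.
Qed.

(** * Block-diagonal matrices *)

Section BlockMatrices.
Variable R : fieldType.

Lemma sub_diag_partE q (M : 'M[R]_q) :
  1%:M - diag_part M = diag_mx (\row_i (1 - M i i)).
Proof. by apply/matrixP=> i j; rewrite !mxE -mulrnBl. Qed.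

Lemma sub_diag_part_unitmx q (M : 'M[R]_q) :
  (forall i, M i i != 1) -> 1%:M - diag_part M \in unitmx.
Proof.
move=> M1; rewrite sub_diag_partE unitmxE det_diag unitfE.
by apply/prodf_neq0 => i _; rewrite mxE subr_eq0 eq_sym.
Qed.

Lemma mulmx_inv_sub_diag_part p q (A : 'M[R]_(p, q)) (M : 'M[R]_q) i j :
    (forall i, M i i != 1) ->
  (A *m invmx (1%:M - diag_part M)) i j = A i j / (1 - M j j).
Proof.
move=> M1; set X := A *m _.
have <- : X *m (1%:M - diag_part M) = A.
  by rewrite mulmxKV ?sub_diag_part_unitmx.
rewrite sub_diag_partE mul_mx_diag !mxE mulfK //.
by rewrite subr_eq0 eq_sym.
Qed.

Lemma rect_mxdiag_eq k (p q : 'I_k -> nat)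
    (A : 'M[R]_(\sum_j p j, \sum_j q j)) (M : forall j, 'M[R]_(p j, q j)) :
    (forall i j r s, i != j -> A (tagnat.Rank i r) (tagnat.Rank j s) = 0) ->
    (forall j r s, A (tagnat.Rank j r) (tagnat.Rank j s) = M j r s) ->
  A = rect_mxdiag M.
Proof.
move=> offdiag ondiag; rewrite -[A]submxblockK; apply: eq_mxblock => i j.
apply/matrixP => r s; rewrite mxE; case: eqVneq => [eij|nij]; last first.
  by rewrite mxE offdiag.
by case: _ / eij s => s; rewrite conform_mx_id ondiag.
Qed.

Lemma rect_mxdiag_square k (p : 'I_k -> nat) (M : forall j, 'M[R]_(p j)) :
  rect_mxdiag M = \mxdiag_j M j.
Proof.
apply: eq_mxblock => i j; case: eqVneq => // eij.
by case: _ / eij; rewrite !conform_mx_id.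
Qed.

End BlockMatrices.

(** * Block decomposition of the PTDF and LODF matrices *)

Theorem proposition4p3 (R : realFieldType) (n m k : nat)
    (G : power_network R n m)
    (G_connected : connected_by G [set: 'I_m])
    (E : {set 'I_m}) (E_non_cut : non_cut G E)
    (Eb : 'I_k -> {set 'I_m}) (Eb_blocks : block_decomposition G Eb) :
  let EE := fun j => E :&: Eb j in
  let EN := fun j => Eb j :\: EE j in
  forall (rowL : 'I_(\sum_j #|EN j|) -> 'I_m)
         (colL : 'I_(\sum_j #|EE j|) -> 'I_m),
  block_ordering (~: E) rowL -> block_ordering E colL ->
  let D_NE := mxsub rowL colL (ptdf G) in
  let D_EE := mxsub colL colL (ptdf G) in
  let K_NE := mxsub rowL colL (lodf G) in
  let DN := fun j => ptdf_block G (group_of rowL (j := j)) (group_of colL (j := j)) in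
  let DE := fun j => ptdf_block G (group_of colL (j := j)) (group_of colL (j := j)) in
  let K := fun j => DN j *m invmx (1%:M - diag_part (DE j)) in
  [/\ D_NE = rect_mxdiag DN,
      D_EE = \mxdiag_j DE j,
      1%:M - diag_part D_EE \in unitmx
        /\ (forall j, 1%:M - diag_part (DE j) \in unitmx),
      K_NE = D_NE *m invmx (1%:M - diag_part D_EE)
    & K_NE = rect_mxdiag K].
Proof.
move=> EE EN rowL colL ord_row ord_col D_NE D_EE K_NE DN DE K.
have [inj_row _ rowF] := ord_row; have [inj_col colE colF] := ord_col.
have disj i j l : l \in Eb i -> l \in Eb j -> i = j.
  move=> li lj; have [lE|lE] := boolP (l \in E).
    by apply: (block_ordering_disjoint (l := l) ord_col); rewrite inE lE.
  by apply: (block_ordering_disjoint (l := l) ord_row); rewrite !inE (negPf lE).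
have ptdf0 i j l l' : i != j -> l \in Eb i -> l' \in Eb j -> ptdf G l l' = 0.
  move=> nij li l'j; apply: contraNeq nij => /flow_same_block same.
  (* The class of [l'] is itself a block. *)
  have [_ classes] := Eb_blocks.
  have [_ /(_ _)[|h EbE]] := classes [set a | `[< same_block G l' a >]].
    by exists l' => a; rewrite inE; split=> /asboolP.
  have l'h : l' \in Eb h by rewrite EbE inE; apply/asboolP; left.
  have lh : l \in Eb h by rewrite EbE inE; apply/asboolP.
  by rewrite (disj _ _ _ li lh) (disj _ _ _ l'j l'h).
have row_mem j r : rowL (tagnat.Rank j r) \in Eb j.
  by have := rowF j r; rewrite !inE => /andP[].
have col_mem j r : colL (tagnat.Rank j r) \in Eb j.
  by have := colF j r; rewrite inE => /andP[].
have DNE j r s :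
    DN j r s = ptdf G (rowL (tagnat.Rank j r)) (colL (tagnat.Rank j s)).
  by rewrite /DN ptdf_blockE ?mxE //; apply: group_of_inj.
have DEE j r s :
    DE j r s = ptdf G (colL (tagnat.Rank j r)) (colL (tagnat.Rank j s)).
  by rewrite /DE ptdf_blockE ?mxE //; apply: group_of_inj.
have ptdf1 s : ptdf G (colL s) (colL s) != 1.
  apply: (@ptdf_neq1 _ _ _ G (~: E)); last by have [] := E_non_cut.
  by rewrite inE negbK; apply/colE; exists s.
have D1 s : D_EE s s != 1 by rewrite mxE.
have DE1 j s : DE j s s != 1 by rewrite DEE.
split.
- by apply: rect_mxdiag_eq => [i j r s nij|j r s]; rewrite mxE ?DNE // (ptdf0 i j).
- rewrite -rect_mxdiag_square.
  by apply: rect_mxdiag_eq => [i j r s nij|j r s]; rewrite mxE ?DEE // (ptdf0 i j).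
- by split=> [|j]; apply: sub_diag_part_unitmx.
- by apply/matrixP => r s; rewrite mulmx_inv_sub_diag_part // !mxE.
- apply: rect_mxdiag_eq => [i j r s nij|j r s]; rewrite mxE [LHS]mxE.
    by rewrite (ptdf0 i j) ?mul0r.
  by rewrite -[RHS]/((_ *m _) r s) mulmx_inv_sub_diag_part // DNE DEE.
Qed.
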